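(* Let $M=(\mathcal{S},\mathcal{X},\{\mathcal{T}^{(x)}\})$ be an edge-emitting hidden Markov model with $n=|\mathcal{S}|$ states and $m=|\mathcal{X}|$ symbols. A pair of distinct states of $M$ ends up marked under the table-filling algorithm described in the context if and only if the pair is path-mergeable. Consequently, $M$ is path-mergeable if and only if all pairs of distinct states end up marked. Moreover, the algorithm can be implemented with maximum run time $O(m\cdot n^4)$.
   Context: Edge-emitting HMM: a triple $(\mathcal{S},\mathcal{X},\{\mathcal{T}^{(x)}\}_{x\in\mathcal{X}})$ with $\mathcal{S}$ a finite set of states, $\mathcal{X}$ a finite alphabet, and $\mathcal{T}^{(x)}$ nonnegative $|\mathcal{S}|\times|\mathcal{S}|$ matrices whose sum is stochastic; $\mathcal{T}^{(x)}_{ij}$ is the probability of transitioning from $i$ to $j$ while emitting $x$. For a word $w=x_1\cdots x_\ell$, $\delta_i(w)$ is the set of states $j$ to which $i$ can transition while emitting $w$, i.e. $j\in\delta_i(w)$ iff $(\mathcal{T}^{(x_1)}\cdots\mathcal{T}^{(x_\ell)})_{ij}>0$; $\delta_i(\lambda)=\{i\}$ for the empty word $\lambda$. A pair of states $i,j$ is path-mergeable if there exist a word $w$ and a state $k$ with $k\in\delta_i(w)\cap\delta_j(w)$. $M$ is path-mergeable if each pair of distinct states is path-mergeable. Table-filling algorithm: (1) Initialization: create a table with one box for each (unordered) pair of distinct states $(i,j)$, all initially unmarked; then mark the box for $(i,j)$ if there is a symbol $x$ with $\delta_i(x)\cap\delta_j(x)\neq\emptyset$. (2) Induction: if the box for $(i',j')$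 is already marked and $i'\in\delta_i(x)$, $j'\in\delta_j(x)$ for some symbol $x$, then mark the box for $(i,j)$; repeat until no new boxes can be marked this way. Run time counts elementary operations, where the input specifies for each $(i,j,x)$ whether $\mathcal{T}^{(x)}_{ij}>0$. *)

(* Defs.v *)
From HB Require Import structures.
From mathcomp Require Import all_boot all_order all_algebra.

Set Implicit Arguments.
Unset Strict Implicit.
Unset Printing Implicit Defensive.

Import Order.TTheory GRing.Theory Num.Theory.
Local Open Scope ring_scope.

(* Matrices are indexed by ordinals; a state i is row/column [enum_rank i]. *)
Record hmm (R : realFieldType) (S X : finType) := HMM {
  trans : X -> 'M[R]_#|S|;
  trans_ge0 : forall x i j, 0 <= trans x i j;
  trans_stochastic : forall i, \sum_j (\sum_x trans x) i j = 1
}.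

Section PathMergeability.
Variables (R : realFieldType) (S X : finType) (M : hmm R S X).

Definition word_trans (w : seq X) : 'M[R]_#|S| :=
  foldr (fun x A => trans M x *m A) 1%:M w.

Definition delta (i : S) (w : seq X) : {set S} :=
  [set j | 0 < word_trans w (enum_rank i) (enum_rank j)].

Definition path_mergeable (i j : S) : Prop :=
  exists (w : seq X) (k : S), k \in delta i w :&: delta j w.

Definition hmm_path_mergeable : Prop :=
  forall i j : S, i != j -> path_mergeable i j.

End PathMergeability.

Section TableFilling.
Variables (R : realFieldType) (S X : finType) (M : hmm R S X).

(* The box of the unordered pair of distinct states i, j is [set i; j]; a table
   is the set of its marked boxes. *)
Definition table : finType := {set {set S}}.

Definition init_rule (T : table) (i j : S) : bool :=
  [exists x, delta M i [:: x] :&: delta M j [:: x] != set0].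

Definition ind_rule (T : table) (i j : S) : bool :=
  [exists x, exists i' in delta M i [:: x], exists j' in delta M j [:: x],
     (i' != j') && ([set i'; j'] \in T)].

Definition mark (rule : table -> rel S) : rel table :=
  fun T T' => [exists i, exists j,
    [&& i != j, [set i; j] \notin T, rule T i j & T' == [set i; j] |: T]].

(* Starting from T, boxes are marked one at a time according to [rule], in any
   order, until no new box can be marked; ts lists the tables following T.
   Idle steps are allowed so that the same notion applies to the successive
   memory states of a program. *)
Definition exhausts (rule : table -> rel S) (T : table) (ts : seq table) :=
  path (fun T1 T2 => (T1 == T2) || mark rule T1 T2) T ts /\
  (forall T', ~~ mark rule (last T ts) T').

Definition table_filling_run (ts : seq table) : Prop :=
  exists ts1 ts2 : seq table,
    [/\ ts = set0 :: ts1 ++ ts2,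
        exhausts init_rule set0 ts1
      & exhausts ind_rule (last set0 ts1) ts2].

Definition table_filling_result (T : table) : Prop :=
  exists2 ts : seq table, table_filling_run ts & T = last set0 ts.

End TableFilling.

(* Cost model: while programs over a random access memory. Registers and memory
   cells hold natural numbers, and the memory consists of arrays; a program
   mentions finitely many registers and arrays. There is no unit-cost
   multiplication. *)
Record state := State {
  reg : nat -> nat;
  mem : nat -> nat -> nat   (* [mem t a] is cell a of array t *)
}.

Definition set_reg (s : state) (r v : nat) : state :=
  State (fun r' => if r' == r then v else reg s r') (mem s).

Definition set_mem (s : state) (t a v : nat) : state :=
  State (reg s)
    (fun t' a' => if (t' == t) && (a' == a) then v else mem s t' a').

Inductive instr :=
  | Const of nat & nat
  | Add of nat & nat & nat
  | Sub of nat & nat & nat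
  | Read of nat & nat & nat
  | Write of nat & nat & nat.

Definition exec_instr (c : instr) (s : state) : state :=
  match c with
  | Const r k => set_reg s r k
  | Add r a b => set_reg s r (reg s a + reg s b)%N
  | Sub r a b => set_reg s r (reg s a - reg s b)%N
  | Read r t a => set_reg s r (mem s t (reg s a))
  | Write t a b => set_mem s t (reg s a) (reg s b)
  end.

(* The tests compare two registers: [If a b p q] and [While a b p] test whether
   register a is smaller than register b. *)
Inductive program :=
  | Do of instr
  | Seq of program & program
  | If of nat & nat & program & program
  | While of nat & nat & program.

(* [exec p s tr]: started in s, the program p terminates, and tr lists the
   states reached after each elementary operation (instruction or test). The
   run time is [size tr] and the final state is [last s tr]. *)
Inductive exec : program -> state -> seq state -> Prop :=
  | ExecDo c s : exec (Do c) s [:: exec_instr c s]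
  | ExecSeq p q s tr1 tr2 :
      exec p s tr1 -> exec q (last s tr1) tr2 -> exec (Seq p q) s (tr1 ++ tr2)
  | ExecIfTrue a b p q s tr :
      (reg s a < reg s b)%N -> exec p s tr -> exec (If a b p q) s (s :: tr)
  | ExecIfFalse a b p q s tr :
      (reg s b <= reg s a)%N -> exec q s tr -> exec (If a b p q) s (s :: tr)
  | ExecWhileTrue a b p s tr1 tr2 :
      (reg s a < reg s b)%N -> exec p s tr1 ->
      exec (While a b p) (last s tr1) tr2 ->
      exec (While a b p) s (s :: tr1 ++ tr2)
  | ExecWhileFalse a b p s :
      (reg s b <= reg s a)%N -> exec (While a b p) s [:: s].

(* Input convention: registers 0 and 1 hold the numbers n of states and m of
   symbols, and array 0 is the three-dimensional m * n * n bit array telling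
   which transition probabilities are positive, in row-major order. All other
   registers and cells are 0. *)
Definition input_state (R : realFieldType) (S X : finType) (M : hmm R S X) :
    state :=
  State
    (fun r => match r with 0 => #|S| | 1 => #|X| | _ => 0 end)%N
    (fun t a => (t == 0%N) &&
       [exists x : X, exists i : 'I_#|S|, exists j : 'I_#|S|,
          (a == (enum_rank x * #|S| + i) * #|S| + j)%N && (0 < trans M x i j)]).

(* Output convention: the box of the states numbered i < j is cell i * n + j of
   array 1, and it is marked when this cell is nonzero. *)
Definition table_of (S : finType) (s : state) : table S :=
  [set b : {set S} | [exists i, exists j,
     [&& (enum_rank i < enum_rank j)%N, b == [set i; j]
       & mem s 1 (enum_rank i * #|S| + enum_rank j)%N != 0%N]]].

(* Main.v *)
Require Import Defs.
From HB Require Import structures.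
From mathcomp Require Import all_boot all_order all_algebra.
From mathcomp Require Import zify.

Set Implicit Arguments.
Unset Strict Implicit.
Unset Printing Implicit Defensive.

Import Order.TTheory GRing.Theory Num.Theory.
Local Open Scope ring_scope.

(* For an exhausted table, marked pairs are path-mergeable because marking
   extends a merging word by one symbol on the left, and path-mergeable pairs are
   marked by induction on a merging word. For the run time, a work queue makes
   every box be used at most once as the premise of the induction rule: scanning
   the predecessors of one pair costs O(m n^2), and at most n^2 pairs are ever
   queued. The initialization is the same scan, applied to the diagonal pairs
   (k, k). *)

Lemma set2_inj (S : finType) (i j a b : S) :
  i != j -> [set i; j] = [set a; b] -> (i = a /\ j = b) \/ (i = b /\ j = a).
Proof.
move=> ij eqS.
have: i \in [set a; b] by rewrite -eqS set21.
have: j \in [set a; b] by rewrite -eqS set22.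
case/set2P=> Ej; case/set2P=> Ei; move: ij; rewrite Ei Ej ?eqxx // => _.
  by right.
by left.
Qed.

(** * Soundness and completeness of exhaustive marking *)

Section Correctness.
Variables (R : realFieldType) (S X : finType) (M : hmm R S X).
Implicit Types (T : table S) (ts : seq (table S)) (i j k : S) (w : seq X).

Lemma word_trans_ge0 w a b : 0 <= word_trans M w a b.
Proof.
elim: w a b => [|x w IHw] a b /=; first by rewrite mxE ler0n.
by rewrite mxE sumr_ge0 // => c _; rewrite mulr_ge0 ?trans_ge0.
Qed.

Lemma delta1E i x j :
  (j \in delta M i [:: x]) = (0 < trans M x (enum_rank i) (enum_rank j)).
Proof. by rewrite inE /= mulmx1. Qed.

Lemma delta_nil i j : (j \in delta M i [::]) = (i == j).
Proof. by rewrite inE /= mxE (inj_eq enum_rank_inj) ltr0n lt0b. Qed.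

(** An entry of a product of nonnegative matrices is a sum of nonnegative terms, hence positive
    exactly when some intermediate state makes both factors positive. *)
Lemma delta_cons i x w j :
  reflect (exists2 k, k \in delta M i [:: x] & j \in delta M k w)
          (j \in delta M i (x :: w)).
Proof.
rewrite inE /= mxE.
have ge0 c : true -> 0 <= trans M x (enum_rank i) c * word_trans M w c (enum_rank j).
  by rewrite mulr_ge0 ?trans_ge0 ?word_trans_ge0.
rewrite lt_def sumr_ge0 ?andbT //.
apply: (iffP idP) => [|[k]].
  rewrite psumr_neq0 // => /hasP[c _ /=].
  rewrite -(enum_valK c) => gt0; exists (enum_val c).
    rewrite delta1E lt_def trans_ge0 andbT.
    by apply: contraTneq gt0 => ->; rewrite mul0r ltxx.
  rewrite inE lt_def word_trans_ge0 andbT.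
  by apply: contraTneq gt0 => ->; rewrite mulr0 ltxx.
rewrite delta1E inE => ik kj; rewrite psumr_neq0 //; apply/hasP.
by exists (enum_rank k); rewrite ?mem_index_enum //= mulr_gt0.
Qed.

Lemma path_mergeable_sym i j : path_mergeable M i j -> path_mergeable M j i.
Proof. by case=> w [k]; rewrite setIC => ?; exists w, k. Qed.

Lemma path_mergeable_cons x i j i' j' :
  i' \in delta M i [:: x] -> j' \in delta M j [:: x] ->
  path_mergeable M i' j' -> path_mergeable M i j.
Proof.
move=> ii' jj' [w [k /setIP[ik jk]]]; exists (x :: w), k.
by rewrite inE; apply/andP; split; apply/delta_cons; [exists i' | exists j'].
Qed.

Lemma init_ruleP T i j :
  reflect (exists x k, k \in delta M i [:: x] /\ k \in delta M j [:: x])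
          (init_rule M T i j).
Proof.
apply: (iffP existsP) => [[x /set0Pn[k /setIP[]]] | [x [k [ik jk]]]].
  by exists x, k.
by exists x; apply/set0Pn; exists k; rewrite inE ik jk.
Qed.

Lemma ind_ruleP T i j :
  reflect (exists x i' j', [/\ i' \in delta M i [:: x], j' \in delta M j [:: x],
                             i' != j' & [set i'; j'] \in T])
          (ind_rule M T i j).
Proof.
apply: (iffP existsP) => [[x] | [x [i' [j' [ii' jj' ne inT]]]]].
  by case/exists_inP=> i' ii' /exists_inP[j' jj' /andP[ne inT]]; exists x, i', j'.
exists x; apply/exists_inP; exists i' => //; apply/exists_inP.
by exists j'; rewrite ?ne.
Qed.

Lemma markP (rule : table S -> rel S) T T' :
  reflect (exists i j, [/\ i != j, [set i; j] \notin T, rule T i j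
                         & T' = [set i; j] |: T])
          (mark rule T T').
Proof.
apply: (iffP existsP) => [[i /existsP[j /and4P[? ? ? /eqP]]] | [i [j [? ? ? /eqP ?]]]].
  by exists i, j.
by exists i; apply/existsP; exists j; apply/and4P.
Qed.

(** Idle steps change nothing, so an invariant only has to survive a single marking. This serves the
    soundness of both phases and the growth of the table in the second. *)
Lemma mark_run_invariant (rule : table S -> rel S) (P : table S -> Prop) T ts :
  (forall T1 i j, P T1 -> i != j -> rule T1 i j -> P ([set i; j] |: T1)) ->
  path (fun T1 T2 => (T1 == T2) || mark rule T1 T2) T ts -> P T -> P (last T ts).
Proof.
move=> step; elim: ts T => //= T1 ts IHts T /andP[/orP[/eqP<- | mk]] /IHts // IH PT.
by apply: IH; case/markP: mk => i [j [ij _ rij ->]]; apply: step.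
Qed.

Lemma exhausted_rule (rule : table S -> rel S) T i j :
  (forall T', ~~ mark rule T T') -> i != j -> rule T i j -> [set i; j] \in T.
Proof.
move=> ex ij rij; apply/negPn/negP => nT; case/negP: (ex ([set i; j] |: T)).
by apply/markP; exists i, j.
Qed.

(** Each marking strictly shrinks the finite set [~: T], so greedy marking stops. *)
Lemma exhausts_exists (rule : table S -> rel S) T : exists ts, exhausts rule T ts.
Proof.
have [k] := ubnP #|~: T|; elim: k => // k IHk in T *; rewrite ltnS => leTk.
have [/existsP[T' mk] | /existsPn ex] := boolP [exists T', mark rule T T'].
  have [|ts [p_ts ex_ts]] := IHk T'.
    case/markP: mk => i [j [_ nT _ ->]]; apply: leq_trans leTk.
    rewrite proper_card // properC; apply/properP; split; first exact: subsetUr.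
    by exists [set i; j]; rewrite ?setU11.
  by exists (T' :: ts); split=> //=; rewrite mk orbT.
by exists [::].
Qed.

Lemma table_filling_result_exists : exists T, table_filling_result M T.
Proof.
have [ts1 ex1] := exhausts_exists (init_rule M) set0.
have [ts2 ex2] := exhausts_exists (ind_rule M) (last set0 ts1).
by eexists; exists (set0 :: ts1 ++ ts2) => //; exists ts1, ts2.
Qed.

Lemma table_filling_sound T i j :
  table_filling_result M T -> i != j -> [set i; j] \in T -> path_mergeable M i j.
Proof.
pose P (T : table S) :=
  forall i j, i != j -> [set i; j] \in T -> path_mergeable M i j.
have P_mark T1 a b : P T1 -> path_mergeable M a b -> P ([set a; b] |: T1).
  move=> PT1 ab c d cd; rewrite in_setU1 => /orP[/eqP|]; last exact: PT1.
  by case/(set2_inj cd) => -[-> ->] //; apply: path_mergeable_sym.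
case=> _ [ts1 [ts2 [-> [p1 _] [p2 _]]] ->] ij; rewrite /= last_cat.
move: i j ij; apply: (mark_run_invariant (P := P) _ p2).
  move=> T1 a b PT1 _ /ind_ruleP[x [a' [b' [aa' bb' ne inT]]]].
  by apply: P_mark => //; apply: path_mergeable_cons aa' bb' (PT1 _ _ ne inT).
apply: (mark_run_invariant (P := P) _ p1); last by move=> a b _; rewrite inE.
move=> T1 a b PT1 _ /init_ruleP[x [k [ak bk]]].
by apply: P_mark => //; exists [:: x], k; rewrite inE ak.
Qed.

Lemma table_filling_complete T i j :
  table_filling_result M T -> i != j -> path_mergeable M i j -> [set i; j] \in T.
Proof.
case=> _ [ts1 [ts2 [-> [p1 ex1] [p2 ex2]]] ->]; rewrite /= last_cat.
set T1 := last set0 ts1; set T2 := last T1 ts2.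
(* Boxes forced by the initialization survive the second phase. *)
have sT12 : T1 \subset T2.
  apply: (mark_run_invariant (P := fun T => T1 \subset T) _ p2) => // T' a b sT _ _.
  exact: subset_trans sT (subsetU1 _ _).
(* After the first symbol of the merging word the two states either coincide, which is the
   initialization rule, or form a distinct pair with a shorter merging word. *)
move=> ij [w [k /setIP[]]]; elim: w i j ij => [|x w IHw] i j ij.
  by rewrite !delta_nil => /eqP<- /eqP ji; rewrite ji eqxx in ij.
case/delta_cons=> i' ii' i'k /delta_cons[j' jj' j'k].
have [eq_ij' | ne_ij'] := eqVneq i' j'.
  apply/(subsetP sT12)/(exhausted_rule ex1 ij)/init_ruleP.
  by exists x, i'; rewrite {2}eq_ij'.
apply/(exhausted_rule ex2 ij)/ind_ruleP; exists x, i', j'; split=> //.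
exact: IHw i'k j'k.
Qed.

End Correctness.

(** * Program logic *)

Local Notation cell := Defs.mem.

Section Hoare.
Local Open Scope nat_scope.
Variables (S : finType) (rule : table S -> rel S).
Implicit Types (s : state) (p q : program) (Q : state -> Prop).

(** The step relation of [exhausts] pulled back along [table_of], so that a trace of memory states
    maps to a run of tables. *)
Definition step : rel state := fun s s' =>
  (table_of S s == table_of S s') || mark rule (table_of S s) (table_of S s').

Lemma step_quiet s s' : cell s' 1 = cell s 1 -> step s s'.
Proof. by move=> eq1; rewrite /step /table_of eq1 eqxx. Qed.

(* Total correctness with time bound c, every elementary operation leaving the
   table unchanged or marking one box by [rule]. *)
Definition run p s c Q := exists tr,
  [/\ exec p s tr, path step s tr, size tr <= c & Q (last s tr)].

Lemma run_do i s Q :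
  step s (exec_instr i s) -> Q (exec_instr i s) -> run (Do i) s 1 Q.
Proof. by exists [:: exec_instr i s]; split=> //=; [constructor | rewrite andbT]. Qed.

Lemma run_seq p q s c1 c2 Q :
  run p s c1 (fun s' => run q s' c2 Q) -> run (Seq p q) s (c1 + c2) Q.
Proof.
case=> tr1 [e1 p1 l1 [tr2 [e2 p2 l2 Q2]]]; exists (tr1 ++ tr2).
by rewrite cat_path p1 size_cat leq_add // last_cat; split=> //; constructor.
Qed.

Lemma run_if a b p q s c Q :
  (reg s a < reg s b -> run p s c Q) -> (reg s b <= reg s a -> run q s c Q) ->
  run (If a b p q) s c.+1 Q.
Proof.
have [lt_ab /(_ isT)[tr [e1 p1 l1 Q1]] _ | le_ba _ /(_ isT)[tr [e1 p1 l1 Q1]]] := ltnP;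
  by exists (s :: tr); rewrite /= step_quiet //; split=> //; constructor.
Qed.

(** A round costs one test plus [c]; the outer successor pays for the failing test. The bound
    [k < N] is derived from the invariant in each round, so the number of rounds may depend on what
    the body does, as with a growing queue. *)
Lemma run_while a b p N c (Inv : nat -> state -> Prop) s :
  Inv 0 s ->
  (forall k s', Inv k s' -> reg s' a < reg s' b ->
     k < N /\ run p s' c (Inv k.+1)) ->
  run (While a b p) s (N * c.+1).+1
    (fun s' => reg s' b <= reg s' a /\ exists k, Inv k s').
Proof.
move=> inv0 body; rewrite -[N]subn0; move: 0 s inv0 => k s invk.
have [d] := ubnP (N - k); elim: d => // d IHd in k s invk *; rewrite ltnS => le_d.
have [lt_ab | le_ba] := ltnP (reg s a) (reg s b); last first.
  exists [:: s]; rewrite /= step_quiet //.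
  by split=> //; [constructor | split=> //; exists k].
have [lt_kN [tr1 [e1 p1 l1 invS]]] := body _ _ invk lt_ab.
have [|tr2 [e2 p2 l2 Q2]] := IHd k.+1 _ invS.
  by rewrite -ltnS -subSn // subSS; apply: leq_trans le_d _.
exists (s :: tr1 ++ tr2); rewrite /= cat_path p1 p2 step_quiet // last_cat size_cat.
split=> //; first by constructor.
by rewrite ltnS -(subnSK lt_kN) mulSn addSn -addnS leq_add.
Qed.

(** A syntactic over-approximation of the modified registers: by [exec_frame], outer loop counters
    survive inner loops without entering their invariants. *)
Fixpoint written_regs p : seq nat :=
  match p with
  | Do (Const r _) | Do (Add r _ _) | Do (Defs.Sub r _ _) | Do (Read r _ _) => [:: r]
  | Do (Write _ _ _) => [::]
  | Seq p q | If _ _ p q => written_regs p ++ written_regs q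
  | While _ _ p => written_regs p
  end.

Lemma exec_frame p s tr r :
  exec p s tr -> r \notin written_regs p -> reg (last s tr) r = reg s r.
Proof.
elim=> {p s tr} /=.
- by case=> [r' k|r' a b|r' a b|r' t a|t a b] s //=; rewrite inE => /negbTE->.
- move=> p q s tr1 tr2 _ IH1 _ IH2; rewrite mem_cat negb_or last_cat.
  by case/andP=> /IH1 <- /IH2 <-.
- by move=> a b p q s tr _ _ IH; rewrite mem_cat negb_or => /andP[/IH].
- by move=> a b p q s tr _ _ IH; rewrite mem_cat negb_or => /andP[_ /IH].
- by move=> a b p s tr1 tr2 _ _ IH1 _ IH2 nr; rewrite last_cat IH2 ?IH1.
- by [].
Qed.

Lemma run_conseq p s c c' Q Q' :
  run p s c Q -> c <= c' ->
  (forall s', (forall r, r \notin written_regs p -> reg s' r = reg s r) ->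
     Q s' -> Q' s') ->
  run p s c' Q'.
Proof.
case=> tr [e1 p1 l1 Q1] le_c QQ'; exists tr; split=> //; first exact: leq_trans le_c.
by apply: QQ' Q1 => r; apply: exec_frame.
Qed.

Definition block (cs : seq instr) p := foldr (fun i => Seq (Do i)) p cs.

(** Array 1 is the only part of a state that [table_of] reads. *)
Definition quiet i := if i is Write t _ _ then t != 1 else true.

Lemma run_block cs p s c Q :
  all quiet cs -> run p (foldl (fun s' i => exec_instr i s') s cs) c Q ->
  run (block cs p) s (size cs + c) Q.
Proof.
elim: cs s => //= i cs IHcs s /andP[qi qcs] run_p.
rewrite -add1n -addnA; apply/run_seq/run_do; last exact: IHcs.
apply: step_quiet; case: i qi {run_p} => //= t a b.
by rewrite eq_sym => /negbTE->.
Qed.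

Definition for_loop r b p :=
  Seq (Do (Const r 0)) (While r b (Seq p (Do (Add r r 2)))).

(** Besides the body, a round pays for the test and the increment; the final 2 is the initialization
    of the counter and the failing test. *)
Lemma run_for r b p N c s0 (Inv : nat -> state -> Prop) :
  reg s0 b = N -> reg s0 2 = 1 -> r != b -> r != 2 ->
  ~~ has (mem [:: r; b; 2]) (written_regs p) ->
  Inv 0 (set_reg s0 r 0) ->
  (forall k s, k < N -> Inv k s -> reg s r = k ->
     (forall r', r' \notin r :: written_regs p -> reg s r' = reg s0 r') ->
     run p s c (fun s' => Inv k.+1 (set_reg s' r k.+1))) ->
  run (for_loop r b p) s0 (N * c.+2 + 2) (Inv N).
Proof.
move=> regb reg1 rb r2 /hasPn frame inv0 body.
have nw r' : r' \in [:: r; b; 2] -> r' \notin written_regs p.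
  by move=> r'in; apply/negP => /frame /negP.
rewrite addnC -[2 + _]/(1 + (1 + _)); apply/run_seq/run_do; first exact: step_quiet.
(* The bound [k <= N], together with the failing test, forces [k = N] at exit. *)
pose J k s := [/\ k <= N, Inv k s, reg s r = k
  & forall r', r' \notin r :: written_regs p -> reg s r' = reg s0 r'].
have Jb k s : J k s -> reg s b = N /\ reg s 2 = 1.
  case=> _ _ _ fr; rewrite !fr ?inE ?negb_or 1?eq_sym ?(eq_sym b) ?rb ?(eq_sym 2) ?r2 //=;
  by rewrite nw ?inE ?eqxx ?orbT.
have J0 : J 0 (exec_instr (Const r 0) s0).
  by split=> //= [|r']; rewrite ?eqxx // inE negb_or => /andP[/negbTE->].
apply: run_conseq (run_while (N := N) (c := c.+1) J0 _) _ _ => //.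
  move=> k s Jk; have [rb_s r2_s] := Jb _ _ Jk; case: (Jk) => leN invk regk fr.
  rewrite regk rb_s => ltN; split=> //; rewrite -[c.+1]addn1; apply: run_seq.
  apply: run_conseq (body k s ltN invk regk fr) _ _ => // s' fr' inv'.
  have regS : reg s' r + reg s' 2 = k.+1.
    by rewrite !fr' ?regk ?r2_s ?addn1 // nw ?inE ?eqxx ?orbT.
  apply: run_do; first exact: step_quiet.
  rewrite /= regS; split=> //= [|r']; first by rewrite eqxx.
  by move=> nr'; move: (nr'); rewrite inE negb_or => /andP[/negbTE-> /fr' ->]; apply: fr.
move=> s' _ [+ [k Jk]]; have [-> _] := Jb _ _ Jk; case: Jk => leN invk -> _ geN.
by rewrite (_ : N = k) //; apply/eqP; rewrite eqn_leq leN geN.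
Qed.

End Hoare.

(** * The worklist program *)

Local Notation rk := enum_rank.

(* Registers: 0 and 1 hold n and m, 2 and 10 the constants 1 and 0, 3 and 4 the
   tail and the head of the queue. Arrays: 2 and 3 hold the components of the
   queued pairs, and cell r of array 4 holds r * n, which replaces
   multiplication in the computation of addresses. *)
Definition skip := Do (Const 15 0).

Definition enqueue :=
  Seq (Do (Write 1 14 2)) (block [:: Write 2 3 8; Write 3 3 9] (Do (Add 3 3 2))).

(* Marks the box of the states i < j in registers 8 and 9 when the symbol in
   register 7 leads from i to register 5 and from j to register 6. *)
Definition visit :=
  If 8 9
    (block [:: Read 11 4 7; Add 12 11 8; Read 12 4 12; Add 12 12 5; Read 12 0 12;
               Add 13 11 9; Read 13 4 13; Add 13 13 6; Read 13 0 13]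
      (If 10 12
        (If 10 13
          (block [:: Read 14 4 8; Add 14 14 9; Read 15 1 14]
            (If 10 15 skip enqueue))
          skip)
        skip))
    skip.

Definition scan := for_loop 7 1 (for_loop 8 0 (for_loop 9 0 visit)).

(** The [m * n] rounds suffice, since every row index [x * n + i] is below [m * n]. Registers 11 and
    12 run through r and r * n, starting from the zeros of the input. *)
Definition fill_multiples :=
  for_loop 7 1
    (for_loop 8 0 (block [:: Write 4 11 12; Add 11 11 2] (Do (Add 12 12 0)))).

(** Adding register 10, which is zero, copies the counter 16 into registers 5 and 6, so that [scan]
    treats a diagonal pair. *)
Definition init_phase :=
  Seq (Do (Const 2 1))
    (Seq fill_multiples
      (for_loop 16 0 (block [:: Add 5 16 10; Add 6 16 10] scan))).

(* The loops only visit i < j, so a dequeued pair is scanned in both orders. *)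
Definition induction_phase :=
  While 4 3
    (block [:: Read 5 2 4; Read 6 3 4]
      (Seq scan
        (block [:: Read 5 3 4; Read 6 2 4]
          (Seq scan (Do (Add 4 4 2)))))).

Lemma row_major_inj n a a' b b' :
  (b < n -> b' < n -> a * n + b = a' * n + b' -> a = a' /\ b = b')%N.
Proof.
move=> ltb ltb' eq_ab; have n0 := leq_ltn_trans (leq0n b) ltb.
split; first by have := congr1 (divn^~ n) eq_ab; rewrite !divnMDl // !divn_small ?addn0.
by have := congr1 (modn^~ n) eq_ab; rewrite !modnMDl !modn_small.
Qed.

Lemma rank_inj (D : finType) (d d' : D) : rk d = rk d' :> nat -> d = d'.
Proof. by move=> /val_inj/enum_rank_inj. Qed.

Lemma rank_lt_total (D : finType) (d d' : D) :
  d != d' -> ((rk d < rk d') || (rk d' < rk d))%N.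
Proof. by rewrite -neq_ltn; apply: contraNneq => /rank_inj->. Qed.

(** * Tables represented by a queue of ordered pairs *)

Section TableFillingProgram.
Local Open Scope nat_scope.
Variables (R : realFieldType) (S X : finType) (M : hmm R S X).
Implicit Types (s : state) (q : seq (S * S)) (T : table S).
Let n := #|S|.
Let m := #|X|.

Lemma input_cell x i j :
  cell (input_state M) 0 ((rk x * n + rk i) * n + rk j) = (j \in delta M i [:: x]).
Proof.
rewrite /= delta1E; congr nat_of_bool; apply/existsP/idP => [[x' /existsP[i' /existsP[j']]] | gt0].
  case/andP=> /eqP/row_major_inj[] // /row_major_inj[] //.
  by move=> /rank_inj-> /val_inj-> /val_inj->.
by exists x; apply/existsP; exists (rk i); apply/existsP; exists (rk j); rewrite eqxx.
Qed.

Definition boxes q : table S := [set [set p.1; p.2] | p in q].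

Definition ordered_pairs q := forall p, p \in q -> rk p.1 < rk p.2.

(** Ordering the components selects one representative per box, so the box cannot stem from the
    swapped pair. *)
Lemma mem_boxes q i j :
  ordered_pairs q -> rk i < rk j -> ([set i; j] \in boxes q) = ((i, j) \in q).
Proof.
move=> ord_q lt_ij; apply/imsetP/idP => [[[a b] ab /= eq_ij] | ij]; last by exists (i, j).
have ne_ij: i != j by apply: contraTneq lt_ij => ->; rewrite ltnn.
case: (set2_inj ne_ij eq_ij) => -[eqi eqj]; subst => //.
by have /= := ord_q _ ab; rewrite ltnNge ltnW.
Qed.

Lemma boxes_rcons q p : boxes (rcons q p) = [set p.1; p.2] |: boxes q.
Proof.
apply/setP=> b; rewrite in_setU1; apply/imsetP/predU1P => [[p'] | [->|/imsetP[p' p'q ->]]].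
- rewrite mem_rcons inE => /predU1P[-> | p'q] ->; first by left.
  by right; apply: imset_f.
- by exists p; rewrite // mem_rcons mem_head.
- by exists p'; rewrite // mem_rcons inE p'q orbT.
Qed.

Lemma boxes_prefix q q' : prefix q q' -> boxes q \subset boxes q'.
Proof. by case/prefixP=> q1 ->; apply/imsetS/subsetP/mem_subseq/prefix_subseq. Qed.

Definition marks s q :=
  forall i j, rk i < rk j -> (cell s 1 (rk i * n + rk j) != 0) = ((i, j) \in q).

Lemma table_of_marks s q : ordered_pairs q -> marks s q -> table_of S s = boxes q.
Proof.
move=> ord_q mk; apply/setP=> b; rewrite inE; apply/existsP/imsetP.
  by case=> i /existsP[j /and3P[lt_ij /eqP-> ]]; rewrite mk //; exists (i, j).
case=> -[i j] ij ->; exists i; apply/existsP; exists j.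
by have lt_ij := ord_q _ ij; rewrite lt_ij eqxx mk.
Qed.

(** Dequeued pairs stay in [q], so [q] lists all marked boxes. The head of the queue, register 4, is
    left out and tracked by the induction phase alone. *)
Record queue_state s q : Prop := QueueState {
  reg_n : reg s 0 = n;
  reg_m : reg s 1 = m;
  reg_one : reg s 2 = 1;
  reg_zero : reg s 10 = 0;
  reg_tail : reg s 3 = size q;
  cell_input : forall x i j,
    cell s 0 ((rk x * n + rk i) * n + rk j) = (j \in delta M i [:: x]);
  cell_multiple : forall r, r < m * n -> cell s 4 r = r * n;
  cell_fst : forall p k, k < size q -> cell s 2 k = rk (nth p q k).1;
  cell_snd : forall p k, k < size q -> cell s 3 k = rk (nth p q k).2;
  queue_ordered : ordered_pairs q;
  queue_uniq : uniq q;
  queue_marks : marks s q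
}.

Lemma queue_state_ext s s' q :
  queue_state s q -> (forall r, r \in [:: 0; 1; 2; 3; 10] -> reg s' r = reg s r) ->
  cell s' = cell s -> queue_state s' q.
Proof.
move=> qs eqr eqc.
by split; rewrite /marks ?eqc ?eqr //; case: qs.
Qed.

Lemma table_of_queue s q : queue_state s q -> table_of S s = boxes q.
Proof. by move=> qs; apply: table_of_marks; [apply: queue_ordered qs | apply: queue_marks]. Qed.

(** No pair is queued twice; this bounds the rounds of the induction phase. *)
Lemma size_queue s q : queue_state s q -> size q <= n ^ 2.
Proof. by move/queue_uniq/card_uniqP <-; rewrite -mulnn -card_prod max_card. Qed.

Definition extends q (P : seq (S * S) -> Prop) s :=
  exists2 q', queue_state s q' & prefix q q' /\ P q'.

(** * Effect and cost of the subprograms *)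

Section Rule.
Variable rule : table S -> rel S.

(** The counter runs through the ranks of [D]. As the queue may grow in every round, [done] must be
    stable under extension for earlier rounds to count at the end. *)
Lemma run_for_queue (D : finType) (done : D -> seq (S * S) -> Prop) r b p c s0 q0 :
  reg s0 b = #|D| -> queue_state s0 q0 ->
  r != b -> r \notin [:: 0; 1; 2; 3; 10] ->
  ~~ has (mem [:: r; b; 2]) (written_regs p) ->
  (forall d q q', prefix q q' -> done d q -> done d q') ->
  (forall d s q, queue_state s q -> prefix q0 q -> reg s r = rk d ->
     (forall r', r' \notin r :: written_regs p -> reg s r' = reg s0 r') ->
     run rule p s c (extends q (done d))) ->
  run rule (for_loop r b p) s0 (#|D| * c.+2 + 2) (extends q0 (fun q => forall d, done d q)).
Proof.
move=> regb qs0 rb r_free frame mono body.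
have set_r s q v : queue_state s q -> queue_state (set_reg s r v) q.
  move=> qs; apply: queue_state_ext qs _ _ => // r' r'in /=.
  by case: eqP r_free => // <-; rewrite r'in.
pose Inv k s := extends q0 (fun q => forall d : D, rk d < k -> done d q) s.
apply: run_conseq (run_for (Inv := Inv) regb (reg_one qs0) rb _ frame _ _) _ _ => //.
- by apply: contraNneq r_free => ->.
- by exists q0; [apply: set_r | rewrite prefix_refl].
- move=> k s ltk [q qs [q0q doneq]] regk fr.
  pose d := enum_val (Ordinal ltk).
  have rkd : rk d = k :> nat by rewrite enum_valK.
  apply: run_conseq (body d s q qs q0q _ fr) _ _; rewrite ?rkd //.
  move=> s' _ [q' qs' [qq' doned]]; exists q'; first exact: set_r.
  split=> [|d']; first exact: prefix_trans qq'.
  rewrite ltnS leq_eqVlt -rkd => /predU1P[/rank_inj -> // | ].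
  by rewrite rkd => /doneq; apply: mono.
by move=> s _ [q qs [q0q doneq]]; exists q => //; split=> // d; apply: doneq.
Qed.

Lemma ordered_pairs_rcons q i j :
  ordered_pairs q -> rk i < rk j -> ordered_pairs (rcons q (i, j)).
Proof.
by move=> ord_q lt_ij p; rewrite mem_rcons inE => /predU1P[-> | /ord_q].
Qed.

Lemma run_enqueue s q i j :
  queue_state s q -> reg s 8 = rk i -> reg s 9 = rk j ->
  reg s 14 = rk i * n + rk j -> rk i < rk j -> (i, j) \notin q ->
  rule (boxes q) i j ->
  run rule enqueue s 4 (queue_state ^~ (rcons q (i, j))).
Proof.
move=> qs r8 r9 r14 lt_ij nq rule_ij; rewrite -[4]/(1 + (2 + 1)).
have ord_q' := ordered_pairs_rcons (queue_ordered qs) lt_ij.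
have mk_q' : marks (exec_instr (Write 1 14 2) s) (rcons q (i, j)).
  move=> i' j' lt_ij' /=; rewrite (reg_one qs) r14 mem_rcons inE -(queue_marks qs) //.
  case: (eqVneq (rk i' * n + rk j') (rk i * n + rk j)) => [eq_ij | ne].
    have [] := row_major_inj (ltn_ord (rk j')) (ltn_ord (rk j)) eq_ij.
    by move=> /rank_inj-> /rank_inj->; rewrite eqxx.
  by case: ((i', j') =P (i, j)) => // -[ei ej]; rewrite ei ej eqxx in ne.
(* This write is the one operation that changes the table; the other three let the queue catch
   up. *)
apply/run_seq/run_do.
  rewrite /step (table_of_queue qs) (table_of_marks ord_q' mk_q') boxes_rcons.
  apply/orP; right; apply/markP; exists i, j; split=> //.
    by apply: contraTneq lt_ij => ->; rewrite ltnn.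
  by rewrite mem_boxes //; apply: queue_ordered qs.
apply: run_block => //; apply: run_do; first exact: step_quiet.
have lt_size k : k < size (rcons q (i, j)) -> k != reg s 3 -> k < size q.
  by rewrite size_rcons (reg_tail qs) ltnS leq_eqVlt => /predU1P[->|//]; rewrite eqxx.
split=> //=; try by case: qs.
- by rewrite (reg_tail qs) (reg_one qs) size_rcons addn1.
- move=> p k ltk; case: eqVneq => [->|/(lt_size _ ltk) ltq]; rewrite nth_rcons.
    by rewrite (reg_tail qs) ltnn eqxx r8.
  by rewrite ltq (cell_fst qs p).
- move=> p k ltk; case: eqVneq => [->|/(lt_size _ ltk) ltq]; rewrite nth_rcons.
    by rewrite (reg_tail qs) ltnn eqxx r9.
  by rewrite ltq (cell_snd qs p).
by rewrite rcons_uniq nq (queue_uniq qs).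
Qed.

(** Closure under one instance of a marking rule with premise pair (a, b), for ordered
    representatives. *)
Definition covered (x : X) (a b i j : S) q : Prop :=
  rk i < rk j -> a \in delta M i [:: x] -> b \in delta M j [:: x] -> (i, j) \in q.

Lemma run_skip s c Q : 0 < c -> Q (exec_instr (Const 15 0) s) -> run rule skip s c Q.
Proof.
move=> c0 Qs; apply: run_conseq (run_do (Q := Q) _ _) c0 _ => //.
exact: step_quiet.
Qed.

(** The longest branch has four tests, twelve instructions that compute addresses and read cells,
    and the four of [enqueue]. *)
Lemma run_visit s q x a b i j :
  queue_state s q -> reg s 5 = rk a -> reg s 6 = rk b -> reg s 7 = rk x ->
  reg s 8 = rk i -> reg s 9 = rk j ->
  (rk i < rk j -> a \in delta M i [:: x] -> b \in delta M j [:: x] ->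
     rule (boxes q) i j) ->
  run rule visit s 20 (extends q (covered x a b i j)).
Proof.
move=> qs r5 r6 r7 r8 r9 rule_ij.
have quiet_regs s' q' : queue_state s' q' -> queue_state (exec_instr (Const 15 0) s') q'.
  by move=> qs'; apply: queue_state_ext qs' _ _ => // r; rewrite !inE => /or4P[|||/orP[]] /eqP->.
have skipE s' c : 0 < c -> queue_state s' q -> covered x a b i j q ->
    run rule skip s' c (extends q (covered x a b i j)).
  by move=> c0 qs' cov; apply: run_skip => //; exists q; rewrite ?prefix_refl //; apply: quiet_regs.
(* The three multiples looked up lie in the filled range of array 4; [m] and [n] are positive
   because a symbol and a state are at hand. *)
have mul_x : cell s 4 (rk x) = rk x * n.
  rewrite (cell_multiple qs) //; apply: leq_trans (ltn_ord (rk x)) _.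
  by rewrite leq_pmulr // (leq_ltn_trans _ (ltn_ord (rk i))).
have mul_xi (k : S) : cell s 4 (rk x * n + rk k) = (rk x * n + rk k) * n.
  rewrite (cell_multiple qs) //.
  apply: (@leq_trans ((rk x).+1 * n)); first by rewrite mulSn addnC ltn_add2r.
  by rewrite leq_mul2r (ltn_ord (rk x)) orbT.
have mul_i : cell s 4 (rk i) = rk i * n.
  rewrite (cell_multiple qs) //; apply: leq_trans (ltn_ord (rk i)) _.
  by rewrite leq_pmull // (leq_ltn_trans _ (ltn_ord (rk x))).
apply: run_if; rewrite r8 r9; last first.
  by move=> le_ji; apply: skipE => // lt_ij; rewrite ltnNge le_ji in lt_ij.
move=> lt_ij; apply: (@run_block _ _ _ _ _ 10) => //.
set s1 := foldl _ _ _.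
have qs1 : queue_state s1 q.
  by apply: queue_state_ext qs _ _ => // r; rewrite !inE => /or4P[|||/orP[]] /eqP->.
have s1_12 : reg s1 12 = (a \in delta M i [:: x]).
  by rewrite /s1 /= r7 mul_x r8 mul_xi r5 (cell_input qs).
have s1_13 : reg s1 13 = (b \in delta M j [:: x]).
  by rewrite /s1 /= r7 mul_x r9 mul_xi r6 (cell_input qs).
have s1_8 : reg s1 8 = rk i by [].
have s1_9 : reg s1 9 = rk j by [].
have {}mul_i : cell s1 4 (rk i) = rk i * n by [].
move: s1 qs1 s1_12 s1_13 s1_8 s1_9 mul_i => {r5 r6 r7 r8 r9 mul_x mul_xi qs}s.
move=> qs r12 r13 r8 r9 mul_i.
apply: run_if; rewrite (reg_zero qs) r12; last first.
  by rewrite leqn0 eqb0 => /negbTE nia; apply: skipE => //; rewrite /covered nia.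
rewrite lt0b => ia; apply: run_if; rewrite (reg_zero qs) r13; last first.
  by rewrite leqn0 eqb0 => /negbTE njb; apply: skipE => //; rewrite /covered njb.
rewrite lt0b => jb; apply: (@run_block _ _ _ _ _ 5) => //.
set s1 := foldl _ _ _.
have qs1 : queue_state s1 q.
  by apply: queue_state_ext qs _ _ => // r; rewrite !inE => /or4P[|||/orP[]] /eqP->.
have s1_14 : reg s1 14 = rk i * n + rk j by rewrite /s1 /= r8 mul_i r9.
have s1_15 : reg s1 15 = cell s1 1 (rk i * n + rk j) by rewrite /s1 /= r8 mul_i r9.
have s1_8 : reg s1 8 = rk i by [].
have s1_9 : reg s1 9 = rk j by [].
move: s1 qs1 s1_14 s1_15 s1_8 s1_9 => {r12 r13 r8 r9 mul_i qs}s qs r14 r15 r8 r9.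
apply: run_if; rewrite (reg_zero qs) r15.
  by rewrite lt0n (queue_marks qs) // => inq; apply: skipE.
rewrite leqNgt lt0n (queue_marks qs) // => nq.
apply: run_conseq (run_enqueue qs r8 r9 r14 lt_ij nq _) _ _ => //; first exact: rule_ij.
move=> s' _ qs'; exists (rcons q (i, j)) => //; split; first exact: prefix_rcons.
by rewrite /covered mem_rcons mem_head.
Qed.

Lemma covered_prefix x a b i j q q' :
  prefix q q' -> covered x a b i j q -> covered x a b i j q'.
Proof.
move=> qq' cov lt_ij ia jb.
by case/prefixP: qq' => q1 ->; rewrite mem_cat cov.
Qed.

Hypothesis n_gt0 : 0 < n.

(** Without symbols the transition matrices sum to zero, which is not stochastic once a state
    exists. Costs free of [m] can thus be absorbed into multiples of it. *)
Lemma m_gt0 : 0 < m.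
Proof.
rewrite lt0n; apply/eqP => m0.
have := trans_stochastic M (Ordinal n_gt0); rewrite big1 => [/esym/eqP|j _].
  by rewrite oner_eq0.
rewrite big1 ?mxE // => x _.
by have := leq_ltn_trans (leq0n _) (ltn_ord (rk x)); rewrite -[#|_|]/m m0.
Qed.

(** The table grows during the scan, so the rule is required for every table containing the initial
    one. The nested loops cost [22 * m * n ^ 2] plus lower-order terms, absorbed by 40. *)
Lemma run_scan s q a b :
  queue_state s q -> reg s 5 = rk a -> reg s 6 = rk b ->
  (forall x i j T, boxes q \subset T -> i != j ->
     a \in delta M i [:: x] -> b \in delta M j [:: x] -> rule T i j) ->
  run rule scan s (40 * (m * n ^ 2))
    (extends q (fun q' => forall x i j, covered x a b i j q')).
Proof.
move=> qs0 r5 r6 rule_ij; have m0 := m_gt0.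
apply: run_conseq (run_for_queue (c := n * (n * 22 + 4) + 2)
  (done := fun x q => forall i j, covered x a b i j q) _ qs0 _ _ _ _ _) _ _ => //.
- exact: reg_m qs0.
- by move=> x q1 q2 le12 cov i j; apply: covered_prefix le12 _.
- move=> x s1 q1 qs1 qq1 r7 fr1.
  apply: run_conseq (run_for_queue (c := n * 22 + 2)
    (done := fun i q => forall j, covered x a b i j q) _ qs1 _ _ _ _ _) _ _ => //.
  + exact: reg_n qs1.
  + by move=> i q2 q3 le23 cov j; apply: covered_prefix le23 _.
  + move=> i s2 q2 qs2 q12 r8 fr2.
    apply: run_conseq (run_for_queue (c := 20)
      (done := fun j q => covered x a b i j q) _ qs2 _ _ _ _ _) _ _ => //.
    * exact: reg_n qs2.
    * by move=> j q3 q4; apply: covered_prefix.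
    * move=> j s3 q3 qs3 q23 r9 fr3.
      apply: run_visit => //; try by rewrite fr3 ?fr2 ?fr1.
      - by rewrite fr3 ?fr2.
      - by rewrite fr3.
      move=> lt_ij; apply: rule_ij.
        exact: boxes_prefix (prefix_trans qq1 (prefix_trans q12 q23)).
      by apply: contraTneq lt_ij => ->; rewrite ltnn.
  + by rewrite -/n; lia.
by rewrite -/n -/m -mulnn; nia.
Qed.

Lemma run_fill_multiples s :
  reg s 0 = n -> reg s 1 = m -> reg s 2 = 1 -> reg s 11 = 0 -> reg s 12 = 0 ->
  run rule fill_multiples s (12 * (m * n)) (fun s' =>
    [/\ cell s' 0 = cell s 0, cell s' 1 = cell s 1
      & forall r, r < m * n -> cell s' 4 r = r * n]).
Proof.
move=> r0 r1 r2 r11 r12; have m0 := m_gt0.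
(* Both loops share [P], indexed by the number of cells already filled. *)
pose P k s' := [/\ reg s' 11 = k /\ reg s' 12 = k * n, cell s' 0 = cell s 0,
  cell s' 1 = cell s 1 & forall r, r < k -> cell s' 4 r = r * n].
apply: run_conseq (run_for (N := m) (c := n * 5 + 2)
  (Inv := fun k => P (k * n)) _ _ _ _ _ _ _) _ _ => //.
- move=> k s1 ltk [[k11 k12] c0 c1 c4] r7 fr1.
  apply: run_conseq (run_for (N := n) (c := 3)
    (Inv := fun l => P (k * n + l)) _ _ _ _ _ _ _) _ _ => //; rewrite ?fr1 //.
  + by rewrite addn0.
  + move=> l s2 ltl [[l11 l12] d0 d1 d4] r8 fr2.
    apply: (@run_block _ _ _ _ _ 1) => //; apply: run_do; first exact: step_quiet.
    split=> //=; rewrite l11 ?l12 ?fr2 ?fr1 ?r2 ?r0 //; first by split; lia.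
    move=> r; rewrite addnS ltnS leq_eqVlt; case: eqVneq => [-> //|_ /= ltr].
    exact: d4.
  + by move=> s2 _; rewrite -mulSnr.
- have le_mn : m <= m * n by rewrite leq_pmulr.
  by nia.
by move=> s' _ [].
Qed.

End Rule.

(** * The two phases and their run time *)

Hypothesis n_gt0 : 0 < n.

Lemma run_init_phase :
  run (init_rule M) init_phase (input_state M) (60 * (m * n ^ 3)) (fun s =>
    exists2 q, queue_state s q &
      reg s 4 = 0 /\ forall k x i j, covered x k k i j q).
Proof.
have m0 := m_gt0 n_gt0.
(* One constant, the table of multiples, then [n] rounds of two copies and a scan. *)
have le_cost : 1 + (12 * (m * n) + (n * (2 + 40 * (m * n ^ 2)).+2 + 2)) <= 60 * (m * n ^ 3).
  have -> : n ^ 3 = n * n ^ 2 by rewrite expnS.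
  have le1 : m * n <= m * (n * n ^ 2) by rewrite leq_pmul2l // leq_pmulr // expn_gt0 n_gt0.
  have le2 : n <= m * n by rewrite leq_pmull.
  have -> : n * (2 + 40 * (m * n ^ 2)).+2 = 4 * n + 40 * (m * (n * n ^ 2)).
    by rewrite !addSn add0n !mulnS; nia.
  by lia.
apply: run_conseq (_ : run _ _ _ _ (extends [::] (fun q =>
  forall k x i j, covered x k k i j q))) le_cost _; last first.
  by move=> s fr [q qs [_ cov]]; exists q => //; rewrite fr.
apply/run_seq/run_do; first exact: step_quiet.
set s0 := exec_instr _ _; apply: run_seq.
apply: run_conseq (run_fill_multiples (init_rule M) n_gt0 (s := s0) _ _ _ _ _) _ _ => //.
move=> s1 fr1 [c0 c1 c4].
have qs1 : queue_state s1 [::].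
  split=> //; rewrite ?fr1 ?c0 //; first exact: input_cell.
  by move=> i j lt_ij; rewrite c1.
apply: (run_for_queue (done := fun k q => forall x i j, covered x k k i j q)) => //.
- exact: reg_n qs1.
- by move=> k q q' qq' cov x i j; apply: covered_prefix qq' _.
move=> k s q qs _ r16 _; apply: run_block => //.
set s2 := foldl _ _ _.
have qs2 : queue_state s2 q.
  by apply: queue_state_ext qs _ _ => // r; rewrite !inE => /or4P[|||/orP[]] /eqP->.
apply: run_scan => //; rewrite /s2 /= ?(reg_zero qs) ?r16 ?addn0 //.
by move=> x i j T _ _ ik jk; apply/init_ruleP; exists x, k.
Qed.

(** After k rounds the first k queued pairs have all their predecessors queued. Rounds only append,
    and at exit the head has reached the tail, so the whole queue is closed under the rule. *)
Lemma run_induction_phase s0 q0 :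
  queue_state s0 q0 -> reg s0 4 = 0 ->
  run (ind_rule M) induction_phase s0 (100 * (m * n ^ 4))
    (extends q0 (fun q => forall p x i j, p \in q ->
       covered x p.1 p.2 i j q /\ covered x p.2 p.1 i j q)).
Proof.
move=> qs0 r4; have m0 := m_gt0 n_gt0.
pose Inv k s := reg s 4 = k /\ exists2 q, queue_state s q &
  [/\ prefix q0 q, k <= size q & forall p x i j, p \in take k q ->
       covered x p.1 p.2 i j q /\ covered x p.2 p.1 i j q].
have inv0 : Inv 0 s0.
  by split=> //; exists q0 => //; split; rewrite ?prefix_refl // => p x i j; rewrite take0.
apply: run_conseq (run_while (N := n ^ 2)
  (c := 2 + (40 * (m * n ^ 2) + (2 + (40 * (m * n ^ 2) + 1)))) inv0 _) _ _.
- move=> k s [r4s [q qs [q0q le_k cov]]]; rewrite r4s (reg_tail qs) => ltk.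
  split; first exact: leq_trans (size_queue qs).
  (* A default for [nth]; every lookup stays inside the queue. *)
  pose p0 := (enum_val (Ordinal n_gt0), enum_val (Ordinal n_gt0)).
  case Ep: (nth p0 q k) => [a b].
  have abq : (a, b) \in q by rewrite -Ep mem_nth.
  have lt_ab := queue_ordered qs abq.
  have ne_ab : a != b by apply: contraTneq lt_ab => /= ->; rewrite ltnn.
  apply: run_block => //; set s1 := foldl _ _ _.
  have qs1 : queue_state s1 q.
    by apply: queue_state_ext qs _ _ => // r; rewrite !inE => /or4P[|||/orP[]] /eqP->.
  apply: run_seq.
  apply: run_conseq (run_scan n_gt0 (a := a) (b := b) qs1 _ _ _) _ _ => //.
  + by rewrite /s1 /= r4s (cell_fst qs p0) // Ep.
  + by rewrite /s1 /= r4s (cell_snd qs p0) // Ep.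
  + move=> x i j T sT _ ia jb; apply/ind_ruleP; exists x, a, b; split=> //.
    by apply: (subsetP sT); rewrite mem_boxes //; apply: queue_ordered qs.
  move=> s2 fr2 [q2 qs2 [qq2 cov2]].
  have lt_k2 : k < size q2 by apply: leq_trans ltk (size_prefix qq2).
  (* The first scan only appended, so the reversed scan reads the same pair. *)
  have Ep2 : nth p0 q2 k = (a, b) by case/prefixP: qq2 => q' ->; rewrite nth_cat ltk.
  have r4s2 : reg s2 4 = k by rewrite fr2.
  apply: run_block => //; set s3 := foldl _ _ _.
  have qs3 : queue_state s3 q2.
    by apply: queue_state_ext qs2 _ _ => // r; rewrite !inE => /or4P[|||/orP[]] /eqP->.
  apply: run_seq.
  apply: run_conseq (run_scan n_gt0 (a := b) (b := a) qs3 _ _ _) _ _ => //.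
  + by rewrite /s3 /= r4s2 (cell_snd qs2 p0) // Ep2.
  + by rewrite /s3 /= r4s2 (cell_fst qs2 p0) // Ep2.
  + move=> x i j T sT _ ib ja; apply/ind_ruleP; exists x, b, a; split=> //; first by rewrite eq_sym.
    rewrite setUC; apply: (subsetP sT); rewrite mem_boxes //; last exact: queue_ordered qs2.
    by rewrite -Ep2 mem_nth.
  move=> s4 fr4 [q4 qs4 [q24 cov4]].
  apply: run_do; first exact: step_quiet.
  split; first by rewrite /= fr4 // (reg_one qs4) -r4s2 addn1.
  exists q4.
    by apply: queue_state_ext qs4 _ _ => // r; rewrite !inE => /or4P[|||/orP[]] /eqP->.
  have q4q : prefix q q4 := prefix_trans qq2 q24.
  split; first exact: prefix_trans q4q.
    exact: leq_trans ltk (size_prefix q4q).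
  move=> p x i j; rewrite (take_nth p0); last exact: leq_trans (size_prefix q4q).
  have [q' Eq4] := prefixP q4q.
  rewrite {1 2}Eq4 nth_cat ltk Ep takel_cat // mem_rcons inE => /predU1P[-> | pq].
    by split=> /=; [apply: covered_prefix q24 _ | ].
  by have [c1 c2] := cov p x i j pq; split; apply: covered_prefix q4q _.
(* With c for [n ^ 2], the loop costs 6c + 80mc^2 + 1, at most 100mc^2 since m and c are
   positive. *)
- have -> : n ^ 4 = n ^ 2 * n ^ 2 by rewrite -expnD.
  have := expn_gt0 n 2; rewrite n_gt0 /=; move: (n ^ 2) => c c0.
  have le1 : c <= m * (c * c) by nia.
  have -> : c * (2 + (40 * (m * c) + (2 + (40 * (m * c) + 1)))).+1
            = 6 * c + 80 * (m * (c * c)) by nia.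
  by lia.
move=> s _ [le_size [k [r4s [q qs [q0q le_k cov]]]]]; exists q => //; split=> // p x i j pq.
apply: cov; rewrite take_oversize //.
by rewrite -r4s -(reg_tail qs).
Qed.

(** Closure is checked on ordered pairs; symmetry of the rule gives the swapped ones. *)
Lemma exhausted_queue (rule : table S -> rel S) s q :
  queue_state s q -> (forall i j, rule (boxes q) i j -> rule (boxes q) j i) ->
  (forall i j, rk i < rk j -> rule (boxes q) i j -> (i, j) \in q) ->
  forall T, ~~ mark rule (table_of S s) T.
Proof.
move=> qs sym sat T; rewrite (table_of_queue qs); apply/markP => -[i [j [ij]]].
have ord_q := queue_ordered qs.
case/orP: (rank_lt_total ij) => lt_ij /negP nin rij _; apply: nin.
  by rewrite mem_boxes // sat.
by rewrite setUC mem_boxes // sat // sym.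
Qed.

Lemma init_rule_sym T i j : init_rule M T i j -> init_rule M T j i.
Proof. by case/init_ruleP=> x [k [ik jk]]; apply/init_ruleP; exists x, k. Qed.

Lemma ind_rule_sym T i j : ind_rule M T i j -> ind_rule M T j i.
Proof.
case/ind_ruleP=> x [i' [j' [ii' jj' ne inT]]]; apply/ind_ruleP.
by exists x, j', i'; rewrite eq_sym setUC.
Qed.

Lemma run_exhausts (rule : table S -> rel S) s tr :
  path (step rule) s tr -> (forall T, ~~ mark rule (table_of S (last s tr)) T) ->
  exhausts rule (table_of S s) (map (table_of S) tr).
Proof. by move=> p_tr ex; split; [rewrite path_map | rewrite last_map]. Qed.

Lemma table_filling_program : exists tr : seq state,
  [/\ exec (Seq init_phase induction_phase) (input_state M) tr,
      table_filling_run M [seq table_of S s | s <- input_state M :: tr]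
    & size tr <= 160 * (m * n ^ 4)].
Proof.
have [tr1 [e1 p1 l1 [q1 qs1 [r4 cov1]]]] := run_init_phase.
have [tr2 [e2 p2 l2 [q2 qs2 [q12 cov2]]]] := run_induction_phase qs1 r4.
have table0 : table_of S (input_state M) = set0.
  by apply/setP=> b; rewrite inE in_set0; apply/existsP => -[i /existsP[j /and3P[]]].
exists (tr1 ++ tr2); split; first by constructor.
  exists (map (table_of S) tr1), (map (table_of S) tr2).
  rewrite -table0 last_map -map_cat; split=> //; apply: run_exhausts => //.
    apply: (exhausted_queue qs1) => [|i j lt_ij /init_ruleP[x [k [ik jk]]]].
      exact: init_rule_sym.
    exact: cov1 ik jk.
  apply: (exhausted_queue qs2) => [|i j lt_ij]; first exact: ind_rule_sym.
  case/ind_ruleP=> x [i' [j' [ii' jj' ne]]].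
  (* The premise box is queued in one order only, whichever way i' and j' compare; the two scans of
     a dequeued pair answer the two cases. *)
  case/orP: (rank_lt_total ne) => lt_ij'; last rewrite setUC.
    rewrite mem_boxes // => [pq|]; last exact: queue_ordered qs2.
    by have [+ _] := cov2 _ x i j pq; apply.
  rewrite mem_boxes // => [pq|]; last exact: queue_ordered qs2.
  by have [_ +] := cov2 _ x i j pq; apply.
rewrite size_cat; apply: leq_trans (leq_add l1 l2) _.
(* The constant 160 is 60 + 100, one summand per phase. *)
have : m * n ^ 3 <= m * n ^ 4 by rewrite leq_mul2l leq_pexp2l ?orbT.
by lia.
Qed.

End TableFillingProgram.

Theorem mainTheorem3 (R : realFieldType) :
  (forall (S X : finType) (M : hmm R S X),
     (exists T : table S, table_filling_result M T) /\
     (forall T : table S, table_filling_result M T ->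
        (forall i j : S, i != j ->
           ([set i; j] \in T <-> path_mergeable M i j)) /\
        (hmm_path_mergeable M <->
           (forall i j : S, i != j -> [set i; j] \in T)))) /\
  (exists (p : program) (C : nat),
     forall (S X : finType) (M : hmm R S X), (0 < #|S|)%N ->
       exists tr : seq state,
         [/\ exec p (input_state M) tr,
             table_filling_run M
               [seq table_of S s | s <- input_state M :: tr]
           & (size tr <= C * (#|X| * #|S| ^ 4))%N]).
Proof.
split=> [S X M|]; last first.
  by exists (Seq init_phase induction_phase), 160%N => S X M; apply: table_filling_program.
split=> [|T res]; first exact: table_filling_result_exists.
have iffT i j : i != j -> [set i; j] \in T <-> path_mergeable M i j.
  by move=> ij; split; [apply: table_filling_sound | apply: table_filling_complete].
by split=> //; split=> all_ij i j ij; apply/(iffT i j ij)/all_ij.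
Qed.
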